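(* The Regime Classifier algorithm terminates in $\mathcal{O}(m)$ time and $\mathcal{O}(m)$ space using a linear-time partial-selection routine (e.g., introselect or median-of-medians) for the top-$k$ extraction step. With a sort-based implementation the cost is $\mathcal{O}(m\log m)$.
   Context: Regime Classifier algorithm, on input $\hat\lambda\in\mathbb{R}^m_+$, parameters $\Theta=(\delta,\theta,\gamma,k)$ with $0<\delta<\tfrac12$, $\theta\in(\tfrac12,1)$, $\gamma\in(0,1)$, $k\in\{1,\dots,m-1\}$, and tolerance $\varepsilon\ge0$, executes in order: 1. compute $L=\sum_{i=1}^m\hat\lambda_i$; 2. if $L<\delta-\varepsilon$ return unc; 3. if $L\le\delta+\varepsilon$ return hyb; 4. set $\bar\lambda=\hat\lambda/L$; 5. compute the top-$k$ values $\bar\lambda_{(1)}\ge\cdots\ge\bar\lambda_{(k)}$ of $\bar\lambda$ by partial selection (top-$k$ extraction step); 6. set $\Sigma_k=\sum_{j=1}^k\bar\lambda_{(j)}$; 7. if $|\Sigma_k-\theta|\le\varepsilon$ return hyb; 8. if $\Sigma_k>\theta$ return res; 9. set $\sigma_\delta=\frac1m|\{i:\bar\lambda_i>\delta\}|$; 10. if $\sigma_\delta>\gamma$ return sat; 11. set $\tau=\bar\lambda_{(2)}$ (second largest entry); 12. if $|\tau-\delta|\le\varepsilon$ return hyb; 13. if $\tau>\delta$ return coup; 14. return hyb. *)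

(* Defs.v *)
From HB Require Import structures.
From mathcomp Require Import all_boot all_order all_algebra.
From mathcomp Require Import all_classical all_reals all_analysis.

Set Implicit Arguments.
Unset Strict Implicit.
Unset Printing Implicit Defensive.
Import Order.TTheory GRing.Theory Num.Theory.
Import numFieldNormedType.Exports.
Local Open Scope classical_set_scope.
Local Open Scope ring_scope.

(** * The algorithm as a function *)

Inductive regime := unc | hyb | res | sat | coup.

Record instance (R : realType) (m : nat) := Instance {
  lam : m.-tuple R;
  delta : R;
  theta : R;
  gamma : R;
  eps : R;
  topk : nat;
  lam_ge0 : forall i, 0 <= tnth lam i;
  delta_bounds : 0 < delta < 2^-1;
  theta_bounds : 2^-1 < theta < 1;
  gamma_bounds : 0 < gamma < 1;
  eps_ge0 : 0 <= eps;
  topk_bounds : (1 <= topk <= m.-1)%N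
}.

(** [order_stat s j] is the [j.+1]-st largest entry of [s], with multiplicity. *)
Definition order_stat (R : realType) (s : seq R) (j : nat) : R :=
  (sort >=%R s)`_j.

Definition regime_classifier (R : realType) (m : nat) (I : instance R m) :
    regime :=
  let L := \sum_(i < m) tnth (lam I) i in
  if L < delta I - eps I then unc else
  if L <= delta I + eps I then hyb else
  let bar := [tuple tnth (lam I) i / L | i < m] in
  let Sigma := \sum_(j < topk I) order_stat bar j in
  if `|Sigma - theta I| <= eps I then hyb else
  if Sigma > theta I then res else
  let sigma := #|[set i : 'I_m | tnth bar i > delta I]|%:R / m%:R in
  if sigma > gamma I then sat else
  let tau := order_stat bar 1 in
  if `|tau - delta I| <= eps I then hyb else
  if tau > delta I then coup else
  hyb.

(** * A real RAM with recursive procedures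

    A procedure activation owns integer registers, real registers and arrays
    of reals, all addressed by constants of the program text; only array cells
    are addressed by computed indices.  Integers have addition, truncated
    subtraction and quotient but no product, and there is no conversion from
    reals to integers. *)

Inductive iexp :=
  | ILit of nat
  | IVar of nat
  | ILen of nat
  | IAdd of iexp & iexp
  | ISub of iexp & iexp
  | IDiv of iexp & iexp.

Inductive rexp :=
  | RVar of nat
  | RGet of nat & iexp
  | ROfInt of iexp
  | RAdd of rexp & rexp
  | RSub of rexp & rexp
  | RMul of rexp & rexp
  | RDiv of rexp & rexp
  | RAbs of rexp.

Inductive bexp :=
  | BIlt of iexp & iexp
  | BRlt of rexp & rexp
  | BRle of rexp & rexp.

(** [Call a p b e] runs procedure number [p] in a new activation whose array 0
    is a copy of array [b], whose integer register 0 holds [e], and which has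
    nothing else; on exit its array 0 becomes array [a] of the caller. *)
Inductive cmd :=
  | Skip
  | ISet of nat & iexp
  | RSet of nat & rexp
  | New of nat & iexp
  | Put of nat & iexp & rexp
  | Call of nat & nat & nat & iexp
  | Then of cmd & cmd
  | If of bexp & cmd & cmd
  | While of bexp & cmd.

Declare Scope prog_scope.
Delimit Scope prog_scope with prog.
Bind Scope prog_scope with cmd.
Notation "c1 ;; c2" := (Then c1 c2)
  (at level 90, right associativity) : prog_scope.

Fixpoint isize (e : iexp) : nat :=
  match e with
  | ILit _ | IVar _ | ILen _ => 1
  | IAdd e1 e2 | ISub e1 e2 | IDiv e1 e2 => (isize e1 + isize e2).+1
  end.

Fixpoint rsize (e : rexp) : nat :=
  match e with
  | RVar _ => 1
  | RGet _ i | ROfInt i => (isize i).+1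
  | RAdd e1 e2 | RSub e1 e2 | RMul e1 e2 | RDiv e1 e2 =>
      (rsize e1 + rsize e2).+1
  | RAbs e1 => (rsize e1).+1
  end.

Definition bsize (b : bexp) : nat :=
  match b with
  | BIlt e1 e2 => (isize e1 + isize e2).+1
  | BRlt e1 e2 | BRle e1 e2 => (rsize e1 + rsize e2).+1
  end.

Record frame (R : Type) := Frame {
  iregs : seq nat;
  rregs : seq R;
  arrs : seq (seq R)
}.

(** A register counts as used up to the largest one written so far; each array
    counts its cells and one descriptor. *)
Definition cells (R : Type) (f : frame R) : nat :=
  size (iregs f) + size (rregs f) + size (arrs f) + sumn (map size (arrs f)).

Definition iget (R : Type) (f : frame R) (x : nat) : nat := nth 0%N (iregs f) x.
Definition rget (R : realType) (f : frame R) (x : nat) : R := (rregs f)`_x.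
Definition aget (R : Type) (f : frame R) (a : nat) : seq R :=
  nth [::] (arrs f) a.

Definition iset (R : Type) (f : frame R) (x n : nat) : frame R :=
  Frame (set_nth 0%N (iregs f) x n) (rregs f) (arrs f).
Definition rset (R : realType) (f : frame R) (x : nat) (v : R) : frame R :=
  Frame (iregs f) (set_nth 0 (rregs f) x v) (arrs f).
Definition aset (R : Type) (f : frame R) (a : nat) (s : seq R) : frame R :=
  Frame (iregs f) (rregs f) (set_nth [::] (arrs f) a s).

Fixpoint ieval (R : Type) (f : frame R) (e : iexp) : nat :=
  match e with
  | ILit n => n
  | IVar x => iget f x
  | ILen a => size (aget f a)
  | IAdd e1 e2 => ieval f e1 + ieval f e2
  | ISub e1 e2 => ieval f e1 - ieval f e2
  | IDiv e1 e2 => ieval f e1 %/ ieval f e2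
  end%N.

(** Reading past the end of an array gives 0. *)
Fixpoint reval (R : realType) (f : frame R) (e : rexp) : R :=
  match e with
  | RVar x => rget f x
  | RGet a i => (aget f a)`_(ieval f i)
  | ROfInt i => (ieval f i)%:R
  | RAdd e1 e2 => reval f e1 + reval f e2
  | RSub e1 e2 => reval f e1 - reval f e2
  | RMul e1 e2 => reval f e1 * reval f e2
  | RDiv e1 e2 => reval f e1 / reval f e2
  | RAbs e1 => `|reval f e1|
  end.

Definition beval (R : realType) (f : frame R) (b : bexp) : bool :=
  match b with
  | BIlt e1 e2 => (ieval f e1 < ieval f e2)%N
  | BRlt e1 e2 => reval f e1 < reval f e2
  | BRle e1 e2 => reval f e1 <= reval f e2
  end.

Definition call_frame (R : Type) (s : seq R) (n : nat) : frame R :=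
  Frame [:: n] [::] [:: s].

(** [exec P f c t q f']: with the procedures of [P], command [c] started in
    [f] terminates in [f'], after [t] elementary steps, and the number of cells
    in use (in this activation and those below it) never exceeds [q], the value
    [q] being attained.
    - Every operator, access and command is one step; allocating an array costs
      one more step per cell, and so does copying the argument of a call.
    - Writing out of the bounds of an array is stuck.
    - The scratch cells for evaluating one expression are not counted: their
      number is bounded by the program text, and calls do not occur inside
      expressions. *)
Inductive exec (R : realType) (P : seq cmd) :
    frame R -> cmd -> nat -> nat -> frame R -> Prop :=
  | ESkip f : exec P f Skip 1 (cells f) f
  | EISet f x e (f' := iset f x (ieval f e)) :
      exec P f (ISet x e) (isize e).+1 (maxn (cells f) (cells f')) f'
  | ERSet f x e (f' := rset f x (reval f e)) :
      exec P f (RSet x e) (rsize e).+1 (maxn (cells f) (cells f')) f'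
  | ENew f a e (n := ieval f e) (f' := aset f a (nseq n 0)) :
      exec P f (New a e) (isize e + n).+1 (maxn (cells f) (cells f')) f'
  | EPut f a i e (s := aget f a)
      (f' := aset f a (set_nth 0 s (ieval f i) (reval f e))) :
      (ieval f i < size s)%N ->
      exec P f (Put a i e) (isize i + rsize e).+1
        (maxn (cells f) (cells f')) f'
  | ECall f a p b e t q g (s := aget f b) (f' := aset f a (aget g 0)) :
      exec P (call_frame s (ieval f e)) (nth Skip P p) t q g ->
      exec P f (Call a p b e) (isize e + size s + t).+1
        (maxn (cells f + q) (cells f')) f'
  | EThen f1 f2 f3 c1 c2 t1 t2 q1 q2 :
      exec P f1 c1 t1 q1 f2 -> exec P f2 c2 t2 q2 f3 ->
      exec P f1 (Then c1 c2) (t1 + t2) (maxn q1 q2) f3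
  | EIf f f' b c1 c2 t q :
      exec P f (if beval f b then c1 else c2) t q f' ->
      exec P f (If b c1 c2) (bsize b + t).+1 q f'
  | EWhileF f b c :
      ~~ beval f b -> exec P f (While b c) (bsize b).+1 (cells f) f
  | EWhileT f1 f2 f3 b c t1 t2 q1 q2 :
      beval f1 b ->
      exec P f1 c t1 q1 f2 -> exec P f2 (While b c) t2 q2 f3 ->
      exec P f1 (While b c) (bsize b + t1 + t2).+1 (maxn q1 q2) f3.

Definition for_ (x : nat) (n : iexp) (c : cmd) : cmd :=
  ISet x (ILit 0) ;;
  While (BIlt (IVar x) n) (c ;; ISet x (IAdd (IVar x) (ILit 1))).

(** * The algorithm as a program *)

Definition regime_code (r : regime) : nat :=
  match r with unc => 0 | hyb => 1 | res => 2 | sat => 3 | coup => 4 end.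

Definition xk := 0%N.
Definition xi := 1%N.
Definition xcount := 2%N.
Definition xout := 3%N.

Definition ydelta := 0%N.
Definition ytheta := 1%N.
Definition ygamma := 2%N.
Definition yeps := 3%N.
Definition yL := 4%N.
Definition ySigma := 5%N.
Definition ysigma := 6%N.
Definition ymax := 7%N.
Definition ytau := 8%N.

Definition alam := 0%N.
Definition abar := 1%N.
Definition atop := 2%N.

Definition input_frame (R : realType) (m : nat) (I : instance R m) : frame R :=
  Frame [:: topk I] [:: delta I; theta I; gamma I; eps I]
    [:: tval (lam I)].

Definition return_ (r : regime) : cmd := ISet xout (ILit (regime_code r)).

(** The top-[k] extraction step is the call to procedure [p], which must leave
    the top-[k] values in the first [k] cells of the array it returns.  The two
    largest entries are found by one scan; it may start from 0 because the
    entries are nonnegative and there are at least two of them. *)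
Definition classifier (p : nat) : cmd :=
  (RSet yL (ROfInt (ILit 0)) ;;
   for_ xi (ILen alam) (RSet yL (RAdd (RVar yL) (RGet alam (IVar xi)))) ;;
   If (BRlt (RVar yL) (RSub (RVar ydelta) (RVar yeps))) (return_ unc) (
   If (BRle (RVar yL) (RAdd (RVar ydelta) (RVar yeps))) (return_ hyb) (
   New abar (ILen alam) ;;
   for_ xi (ILen alam)
     (Put abar (IVar xi) (RDiv (RGet alam (IVar xi)) (RVar yL))) ;;
   Call atop p abar (IVar xk) ;;
   RSet ySigma (ROfInt (ILit 0)) ;;
   for_ xi (IVar xk)
     (RSet ySigma (RAdd (RVar ySigma) (RGet atop (IVar xi)))) ;;
   If (BRle (RAbs (RSub (RVar ySigma) (RVar ytheta))) (RVar yeps))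
     (return_ hyb) (
   If (BRlt (RVar ytheta) (RVar ySigma)) (return_ res) (
   ISet xcount (ILit 0) ;;
   for_ xi (ILen abar)
     (If (BRlt (RVar ydelta) (RGet abar (IVar xi)))
       (ISet xcount (IAdd (IVar xcount) (ILit 1))) Skip) ;;
   RSet ysigma (RDiv (ROfInt (IVar xcount)) (ROfInt (ILen alam))) ;;
   If (BRlt (RVar ygamma) (RVar ysigma)) (return_ sat) (
   RSet ymax (ROfInt (ILit 0)) ;;
   RSet ytau (ROfInt (ILit 0)) ;;
   for_ xi (ILen abar)
     (If (BRlt (RVar ymax) (RGet abar (IVar xi)))
       (RSet ytau (RVar ymax) ;; RSet ymax (RGet abar (IVar xi)))
       (If (BRlt (RVar ytau) (RGet abar (IVar xi)))
         (RSet ytau (RGet abar (IVar xi))) Skip)) ;;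
   If (BRle (RAbs (RSub (RVar ytau) (RVar ydelta))) (RVar yeps))
     (return_ hyb) (
   If (BRlt (RVar ydelta) (RVar ytau)) (return_ coup)
   (return_ hyb))))))))%prog.

(** * Costs and routines *)

Definition linear_growth (R : realType) (T : nat -> nat) : Prop :=
  (fun m => (T m)%:R : R) =O_\oo (fun m => m%:R : R).

Definition linearithmic_growth (R : realType) (T : nat -> nat) : Prop :=
  (fun m => (T m)%:R : R) =O_\oo (fun m => m%:R * ln m%:R : R).

(** [T] bounds the worst-case time. *)
Definition partial_selection_routine (R : realType) (P : seq cmd) (p : nat)
    (T : nat -> nat) : Prop :=
  forall (s : seq R) (k : nat), (1 <= k <= size s)%N ->
    exists t q g,
      [/\ exec P (call_frame s k) (nth Skip P p) t q g,
          perm_eq (take k (aget g 0)) (take k (sort >=%R s))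
        & (t <= T (size s))%N].

(** The integer argument, which the calling convention supplies, is arbitrary. *)
Definition sorting_routine (R : realType) (P : seq cmd) (p : nat)
    (T : nat -> nat) : Prop :=
  forall (s : seq R) (n : nat),
    exists t q g,
      [/\ exec P (call_frame s n) (nth Skip P p) t q g,
          aget g 0 = sort >=%R s
        & (t <= T (size s))%N].

(* Main.v *)
Require Import Defs.
From HB Require Import structures.
From mathcomp Require Import all_boot all_order all_algebra.
From mathcomp Require Import all_classical all_reals all_analysis.
From mathcomp Require Import zify.
Import Order.TTheory GRing.Theory Num.Theory.
Import numFieldNormedType.Exports.
Local Open Scope ring_scope.

(** Outside its selection step the classifier runs a bounded number of loops of
    at most [m] iterations with constant-time bodies, so it takes [O(m)] steps
    plus the time of the selection routine ([runs_classifier]).  It computes the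
    intended regime because the sum of the top [k] values does not depend on
    their order, and because a left-to-right scan that keeps the two largest
    entries maintains the first two order statistics of the prefix read so far
    ([order_stat_rcons]).  A sorting routine is a selection routine, so both
    time bounds come from this one analysis, the linear part being absorbed by
    [m * ln m] in the sort-based case.

    Space needs no analysis of the algorithm: a program that runs for [t] steps
    allocates [O(t)] cells, for a constant that depends on the program text
    only, because each array cell is paid for by a step and a register number is
    a constant of the text ([exec_space]).  Linear time thus gives linear space.

    A sorting routine with linearithmic time exists on this machine: recursive
    merge sort ([runs_merge_sort]), whose recursion depth is the rounded up
    binary logarithm of the length, each level costing a linear number of
    steps. *)

Set Implicit Arguments.
Unset Strict Implicit.
Unset Printing Implicit Defensive.

(** * Total correctness with a time bound *)

(** The number of cells is left unconstrained: it is bounded afterwards, from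
    the time alone. *)
Definition runs (R : realType) (P : seq cmd) (f : frame R) (c : cmd) (T : nat)
    (Q : frame R -> Prop) : Prop :=
  exists t q f', [/\ exec P f c t q f', (t <= T)%N & Q f'].

Section Runs.
Context {R : realType} {P : seq cmd}.
Implicit Types (f g : frame R) (c : cmd) (Q : frame R -> Prop).

Lemma runs_weaken f c T1 T (Q1 Q : frame R -> Prop) : (T1 <= T)%N ->
  (forall f', Q1 f' -> Q f') -> runs P f c T1 Q1 -> runs P f c T Q.
Proof.
move=> leT1 sQ [t [q [f' [ex let1 /sQ Qf']]]]; exists t, q, f'.
by split=> //; exact: leq_trans leT1.
Qed.

Lemma runs_skip f : runs P f Skip 1 (eq f).
Proof. by exists 1%N, (cells f), f; split=> //; exact: ESkip. Qed.

Lemma runs_iset f x e :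
  runs P f (ISet x e) (isize e).+1 (eq (iset f x (ieval f e))).
Proof. by do 3!eexists; split; first exact: EISet. Qed.

Lemma runs_rset f y e :
  runs P f (RSet y e) (rsize e).+1 (eq (rset f y (reval f e))).
Proof. by do 3!eexists; split; first exact: ERSet. Qed.

Lemma runs_new f a e : runs P f (New a e) (isize e + ieval f e).+1
  (eq (aset f a (nseq (ieval f e) 0))).
Proof. by do 3!eexists; split; first exact: ENew. Qed.

Lemma runs_put f a i e : (ieval f i < size (aget f a))%N ->
  runs P f (Put a i e) (isize i + rsize e).+1
    (eq (aset f a (set_nth 0 (aget f a) (ieval f i) (reval f e)))).
Proof. by move=> lti; do 3!eexists; split; first exact: EPut. Qed.

(** The callee starts from a frame that does not depend on the rest of the
    caller's frame, so its specification can be proved once and for all and only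
    its array 0 is seen by the continuation. *)
Lemma runs_call f a p b e T Q :
  runs P (call_frame (aget f b) (ieval f e)) (nth Skip P p) T
    (fun g => Q (aset f a (aget g 0))) ->
  runs P f (Call a p b e) (isize e + size (aget f b) + T).+1 Q.
Proof.
move=> [t [q [g [ex let1 Qg]]]]; do 3!eexists.
by split; [exact: ECall ex | rewrite ltnS leq_add2l | exact: Qg].
Qed.

Lemma runs_then T1 f c1 c2 T (Q1 Q : frame R -> Prop) :
  runs P f c1 T1 Q1 -> (T1 <= T)%N ->
  (forall f', Q1 f' -> runs P f' c2 (T - T1) Q) ->
  runs P f (c1 ;; c2)%prog T Q.
Proof.
move=> [t1 [q1 [f1 [ex1 let1 /[swap] leT1 /[swap] H /H]]]].
move=> [t2 [q2 [f2 [ex2 let2 Qf2]]]].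
exists (t1 + t2)%N, (maxn q1 q2), f2; split=> //; first exact: EThen ex1 ex2.
by rewrite -(subnKC leT1) leq_add.
Qed.

Lemma runs_then_eq T1 f f1 c1 c2 T Q :
  runs P f c1 T1 (eq f1) -> (T1 <= T)%N -> runs P f1 c2 (T - T1) Q ->
  runs P f (c1 ;; c2)%prog T Q.
Proof. by move=> r1 leT1 r2; apply: runs_then r1 leT1 _ => _ <-. Qed.

Lemma runs_if f b c1 c2 T Q : (bsize b < T)%N ->
  (beval f b -> runs P f c1 (T - (bsize b).+1) Q) ->
  (~~ beval f b -> runs P f c2 (T - (bsize b).+1) Q) ->
  runs P f (If b c1 c2) T Q.
Proof.
move=> ltbT H1 H2.
have [t [q [f' [ex let1 Qf']]]] :
    runs P f (if beval f b then c1 else c2) (T - (bsize b).+1) Q.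
  by case: ifPn.
exists (bsize b + t).+1, q, f'; split=> //; first exact: EIf.
by rewrite -addSn -(subnKC ltbT) leq_add2l.
Qed.

(** An iteration costs [isize n + 3] for the test and the loop command, [B] for
    the body and 4 for the increment; initialising [x] costs 2 and the failing
    test [isize n + 3].  The invariant speaks of the frame after the increment,
    so that it can be an equation with an explicit frame. *)
Lemma runs_for (Inv : nat -> frame R -> Prop) N B f x n c :
  (forall i f', Inv i f' -> iget f' x = i /\ ieval f' n = N) ->
  (forall i f', (i < N)%N -> Inv i f' ->
     runs P f' c B (fun g => Inv i.+1 (iset g x (iget g x).+1))) ->
  Inv 0 (iset f x 0) ->
  runs P f (for_ x n c) (N * (isize n + B + 7) + isize n + 5) (Inv N).
Proof.
move=> Invx body Inv0; apply: runs_then_eq (runs_iset _ _ _) _ _ => /=.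
  by lia.
set w := While _ _.
suff H k i f' : (i + k = N)%N -> Inv i f' ->
    runs P f' w (k * (isize n + B + 7) + isize n + 3) (Inv N).
  by apply: runs_weaken (H N 0%N _ _ Inv0) => //; lia.
elim: k i f' => [|k IHk] i f' ikN Invf'; have [fx fn] := Invx _ _ Invf'.
  exists (isize n + 3)%N, (cells f'), f'; rewrite mul0n add0n.
  split=> //; last by rewrite -ikN addn0.
  have -> : (isize n + 3 = (bsize (BIlt (IVar x) n)).+1)%N by rewrite /=; lia.
  by apply: EWhileF; rewrite /= fx fn -ikN addn0 ltnn.
have ltiN : (i < N)%N by lia.
have [t1 [q1 [f1 [ex1 let1 Inv1]]]] := body _ _ ltiN Invf'.
have /= ex2 := EISet P f1 x (IAdd (IVar x) (ILit 1)).
rewrite [(iget f1 x + 1)%N]addn1 in ex2.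
have [|t3 [q3 [f3 [ex3 let3 Inv3]]]] := IHk i.+1 _ _ Inv1; first by lia.
do 3!eexists; split; last exact: Inv3.
  by apply: EWhileT (EThen ex1 ex2) ex3; rewrite /= fx fn.
by rewrite /= mulSn; lia.
Qed.

End Runs.

(** * Filling an array by a loop *)

Section Fill.
Context {R : realType}.

(** A partially overwritten array is a prefix of the new contents followed by a
    suffix of the old ones; this is the shape of the invariants of all loops
    that write into an array. *)
Lemma set_nth_take_drop (s u : seq R) i : (i < size u)%N ->
  size s = size u ->
  set_nth 0 (take i u ++ drop i s) i u`_i = take i.+1 u ++ drop i.+1 s.
Proof.
move=> ltiu su.
rewrite set_nthE size_cat size_take size_drop ltiu su subnKC ?(ltnW ltiu) //.
rewrite ltiu (take_nth 0 ltiu) take_size_cat ?size_takel ?(ltnW ltiu) //.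
rewrite -cats1 -catA /=; congr (_ ++ _ :: _).
rewrite drop_cat size_takel ?(ltnW ltiu) // ltnNge leqnSn /=.
by rewrite drop_drop subSnn add1n.
Qed.

Lemma aset_aset (f : frame R) a s u : aset (aset f a s) a u = aset f a u.
Proof. by rewrite /aset /= set_set_nth eqxx. Qed.

Lemma iset_iset (f : frame R) x m n : iset (iset f x m) x n = iset f x n.
Proof. by rewrite /iset /= set_set_nth eqxx. Qed.

Lemma rset_rset (f : frame R) y v w : rset (rset f y v) y w = rset f y w.
Proof. by rewrite /rset /= set_set_nth eqxx. Qed.

Lemma iget_iset (f : frame R) x n : iget (iset f x n) x = n.
Proof. by rewrite /iget nth_set_nth /= eqxx. Qed.

Lemma aget_aset (f : frame R) a s : aget (aset f a s) a = s.
Proof. by rewrite /aget nth_set_nth /= eqxx. Qed.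

Lemma aset_aget (f : frame R) a : (a < size (arrs f))%N ->
  aset f a (aget f a) = f.
Proof.
case: f => ir rr ar /= lta; rewrite /aset /aget /=; congr Frame.
apply: (@eq_from_nth _ [::]); first by rewrite size_set_nth (maxn_idPr lta).
by move=> j _; rewrite nth_set_nth /=; case: eqP => [->|].
Qed.

(** The hypotheses on [n] and [e] quantify over arbitrary contents [s] of array
    [a]: neither the bound nor the stored values may depend on what the loop has
    written. *)
Lemma runs_fill P (f : frame R) x n a e (u : seq R) :
  (a < size (arrs f))%N -> size (aget f a) = size u ->
  (forall i s, size s = size u -> ieval (iset (aset f a s) x i) n = size u) ->
  (forall i s, (i < size u)%N -> size s = size u ->
     reval (iset (aset f a s) x i) e = u`_i) ->
  runs P f (for_ x n (Put a (IVar x) e))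
    (size u * (isize n + rsize e + 9) + isize n + 5)
    (eq (iset (aset f a u) x (size u))).
Proof.
move=> lta sza evn eve.
pose F i := iset (aset f a (take i u ++ drop i (aget f a))) x i.
have sz i : size (take i u ++ drop i (aget f a)) = size u.
  by rewrite size_cat size_take_min size_drop sza; lia.
have H : runs P f (for_ x n (Put a (IVar x) e))
    (size u * (isize n + (rsize e + 2) + 7) + isize n + 5)
    (fun f' => f' = F (size u)).
  apply: (runs_for (Inv := fun i f' => f' = F i)) => [i _ ->|i _ ltiu ->|].
  - by rewrite iget_iset evn.
  - have fa : aget (F i) a = take i u ++ drop i (aget f a) by exact: aget_aset.
    apply: runs_weaken (runs_put _ _) => [||/=]; first by rewrite /=; lia.
      move=> _ <- /=; rewrite fa iget_iset eve //.
      rewrite set_nth_take_drop // /F.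
      have -> g s : aset (iset g x i) a s = iset (aset g a s) x i by [].
      by rewrite iget_iset iset_iset aset_aset.
    by rewrite fa sz iget_iset.
  - by rewrite /F take0 drop0 /= aset_aget.
apply: runs_weaken H => [|_ ->]; first by lia.
by rewrite /F take_size drop_oversize ?sza // cats0.
Qed.

End Fill.

(** * Merge sort in linearithmic time *)

(** In the sorting procedure, array 0 is the input and then the output, and
    arrays 1 and 2 are its halves; integer register 1 is the write position,
    registers 2 and 3 are the read positions in the halves.  The recursive calls
    assume that the procedure has number 0. *)
Definition take_left : cmd :=
  (Put 0 (IVar 1) (RGet 1 (IVar 2)) ;; ISet 2 (IAdd (IVar 2) (ILit 1)))%prog.

Definition take_right : cmd :=
  (Put 0 (IVar 1) (RGet 2 (IVar 3)) ;; ISet 3 (IAdd (IVar 3) (ILit 1)))%prog.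

Definition merge_step : cmd :=
  If (BIlt (IVar 2) (ILen 1))
    (If (BIlt (IVar 3) (ILen 2))
      (If (BRle (RGet 2 (IVar 3)) (RGet 1 (IVar 2))) take_left take_right)
      take_left)
    take_right.

Definition merge_sort : cmd :=
  If (BIlt (ILit 1) (ILen 0))
    (New 1 (IDiv (ILen 0) (ILit 2)) ;;
     for_ 1 (ILen 1) (Put 1 (IVar 1) (RGet 0 (IVar 1))) ;;
     New 2 (ISub (ILen 0) (ILen 1)) ;;
     for_ 1 (ILen 2) (Put 2 (IVar 1) (RGet 0 (IAdd (ILen 1) (IVar 1)))) ;;
     Call 1 0 1 (ILit 0) ;;
     Call 2 0 2 (ILit 0) ;;
     ISet 2 (ILit 0) ;;
     ISet 3 (ILit 0) ;;
     for_ 1 (ILen 0) merge_step)%prog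
    Skip.

Section MergeSort.
Context {R : realType}.
Implicit Types (s l r : seq R) (f : frame R).

Lemma runs_take_left P n i j k s l r : (i < size s)%N ->
  runs P (Frame [:: n; i; j; k] [::] [:: s; l; r]) take_left 8
    (eq (Frame [:: n; i; j.+1; k] [::] [:: set_nth 0 s i l`_j; l; r])).
Proof.
move=> ltis; apply: runs_then_eq (runs_put _ _) _ _ => //=.
by apply: runs_weaken (runs_iset _ _ _) => //= f <-; rewrite /iset /= addn1.
Qed.

Lemma runs_take_right P n i j k s l r : (i < size s)%N ->
  runs P (Frame [:: n; i; j; k] [::] [:: s; l; r]) take_right 8
    (eq (Frame [:: n; i; j; k.+1] [::] [:: set_nth 0 s i r`_k; l; r])).
Proof.
move=> ltis; apply: runs_then_eq (runs_put _ _) _ _ => //=.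
by apply: runs_weaken (runs_iset _ _ _) => //= f <-; rewrite /iset /= addn1.
Qed.

(** [merge] is a nested fixpoint, which does not unfold when only its second
    argument is in constructor form. *)
Lemma mergeE s1 s2 : merge >=%R s1 s2 =
  match s1, s2 with
  | [::], _ => s2
  | _, [::] => s1
  | x :: s1', y :: s2' =>
      if y <= x then x :: merge >=%R s1' s2 else y :: merge >=%R s1 s2'
  end.
Proof. by case: s1 => [|x s1] //; case: s2. Qed.

(** Once [i = j + k] cells are written, with [j] taken from the left half and [k]
    from the right one, the unwritten part of the merge is the merge of what
    remains of the two halves.  The head of that merge is the entry that the
    loop body selects. *)
Lemma runs_merge P n i0 s l r : size s = (size l + size r)%N ->
  runs P (Frame [:: n; i0] [::] [:: s; l; r])
    (ISet 2 (ILit 0) ;; ISet 3 (ILit 0) ;; for_ 1 (ILen 0) merge_step)%prog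
    (30 * size s + 10) (fun f => aget f 0 = merge >=%R l r).
Proof.
move=> szs; pose u : seq R := merge >=%R l r; rewrite -/u.
have szu : size u = size s by rewrite /u size_merge size_cat szs.
apply: runs_then_eq (runs_iset _ _ _) _ _ => /=; first by lia.
apply: runs_then_eq (runs_iset _ _ _) _ _ => /=; first by lia.
pose Inv i f := exists2 j, (j <= size l)%N & exists2 k, (k <= size r)%N &
  [/\ (j + k = i)%N, merge >=%R (drop j l) (drop k r) = drop i u &
      f = Frame [:: n; i; j; k] [::] [:: take i u ++ drop i s; l; r]].
have H : runs P (Frame [:: n; i0; 0%N; 0%N] [::] [:: s; l; r])
    (for_ 1 (ILen 0) merge_step)
    (size s * (isize (ILen 0) + 22 + 7) + isize (ILen 0) + 5) (Inv (size s)).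
  have szv i : size (take i u ++ drop i s) = size s.
    by rewrite size_cat size_take_min size_drop szu; lia.
  apply: runs_for => [i f [j _ [k _ [_ _ ->]]]|i f lti [j lej [k lek]]|].
  - by rewrite /= /aget /= szv.
  - case=> jki mE ->.
    have uE : drop i u = u`_i :: drop i.+1 u by rewrite -drop_nth // szu.
    have goL : u`_i = l`_j -> (j < size l)%N ->
        merge >=%R (drop j.+1 l) (drop k r) = drop i.+1 u ->
        runs P (Frame [:: n; i; j; k] [::] [:: take i u ++ drop i s; l; r])
          take_left 8 (fun g => Inv i.+1 (iset g 1 (iget g 1).+1)).
      move=> e ltj me; apply: runs_weaken (runs_take_left _ _ _ _ _ _ _) => //.
        move=> _ <-; rewrite -e set_nth_take_drop ?szu //.
        by exists j.+1 => //; exists k => //; split=> //; lia.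
      by rewrite szv.
    have goR : u`_i = r`_k -> (k < size r)%N ->
        merge >=%R (drop j l) (drop k.+1 r) = drop i.+1 u ->
        runs P (Frame [:: n; i; j; k] [::] [:: take i u ++ drop i s; l; r])
          take_right 8 (fun g => Inv i.+1 (iset g 1 (iget g 1).+1)).
      move=> e ltk me; apply: runs_weaken (runs_take_right _ _ _ _ _ _ _) => //.
        move=> _ <-; rewrite -e set_nth_take_drop ?szu //.
        by exists j => //; exists k.+1 => //; split=> //; lia.
      by rewrite szv.
    rewrite uE mergeE in mE.
    apply: runs_if => //=; rewrite /aget /iget /= -?leqNgt => ltj.
    + rewrite (drop_nth 0 ltj) in mE.
      apply: runs_if => //=; rewrite /aget /iget /= -?leqNgt => ltk.
        rewrite (drop_nth 0 ltk) in mE.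
        apply: runs_if => //=; rewrite /aget /iget /= => cmp.
          rewrite cmp in mE; case: mE => e1 e2.
          by apply: runs_weaken (goL _ _ _) => //; rewrite (drop_nth 0 ltk).
        rewrite (negPf cmp) in mE; case: mE => e1 e2.
        by apply: runs_weaken (goR _ _ _) => //; rewrite (drop_nth 0 ltj).
      rewrite [drop k r]drop_oversize // in mE; case: mE => e1 e2.
      apply: runs_weaken (goL _ _ _) => //.
      by rewrite [drop k r]drop_oversize // mergeE; case: (drop j.+1 l) e2.
    + have ltk : (k < size r)%N by lia.
      rewrite [drop j l]drop_oversize // (drop_nth 0 ltk) in mE.
      case: mE => e1 e2.
      by apply: runs_weaken (goR _ _ _) => //; rewrite drop_oversize.
  - by exists 0%N => //; exists 0%N => //; rewrite !drop0 take0.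
apply: runs_weaken H => [|f]; first by rewrite /=; lia.
case=> j _ [k _ [_ _ ->]]; rewrite /aget /=.
by rewrite drop_size cats0 -szu take_size.
Qed.

(** Each of the [up_log 2 n + 1] levels of the recursion tree costs [O(n)].  A
    call on at most one entry costs 5. *)
Definition merge_sort_time (n : nat) : nat :=
  (100 * (n * (up_log 2 n).+1) + 5)%N.

(** Both halves have at most [(n.-1)./2.+1] entries, the rounded up half of [n],
    so [up_log 2] drops by at least one and the two recursive bounds leave
    [100 * n - 5] for the copies and the merge. *)
Lemma merge_sort_time_rec n : (1 < n)%N ->
  (merge_sort_time (n %/ 2) + merge_sort_time (n - n %/ 2) + 60 * n + 60
   <= merge_sort_time n)%N.
Proof.
move=> n1; have ul : up_log 2 n = (up_log 2 (n.-1 %/ 2).+1).+1.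
  by rewrite -{1}(prednK (ltnW n1)) up_log2S ?divn2 //; lia.
have h1 : (up_log 2 (n %/ 2) < up_log 2 n)%N.
  by rewrite ul ltnS leq_up_log //; lia.
have h2 : (up_log 2 (n - n %/ 2) < up_log 2 n)%N.
  by rewrite ul ltnS leq_up_log //; lia.
rewrite /merge_sort_time.
have := leq_mul (leqnn (n %/ 2)) h1.
have := leq_mul (leqnn (n - n %/ 2)) h2.
have e : (n %/ 2 + (n - n %/ 2) = n)%N by lia.
move: (up_log 2 n) => U; rewrite [(n * U.+1)%N]mulnS.
have -> : (n * U = n %/ 2 * U + (n - n %/ 2) * U)%N by rewrite -mulnDl e.
lia.
Qed.

Lemma runs_merge_sort s n : runs [:: merge_sort] (call_frame s n) merge_sort
  (merge_sort_time (size s)) (fun g => aget g 0 = sort >=%R s).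
Proof.
elim: {s}_.+1 {-2}s n (ltnSn (size s)) => // N IH s n /ltnSE leN.
apply: runs_if => [|/=|/=]; rewrite ?/aget /=.
- by rewrite /merge_sort_time; lia.
- move=> lt1; have rec := merge_sort_time_rec lt1.
  set h := (size s %/ 2)%N in rec *.
  have leh : (h <= size s)%N by lia.
  pose l := take h s; pose r := drop h s.
  have szl : size l = h by rewrite size_takel.
  have szr : size r = (size s - h)%N by rewrite size_drop.
  apply: runs_then_eq (runs_new _ _ _) _ _ => /=; rewrite /aget /= -/h.
    by lia.
  apply: (runs_then_eq (T1 := h * 12 + 6)
    (f1 := Frame [:: n; h] [::] [:: s; l])).
  + apply: runs_weaken (runs_fill _ (u := l) _ _ _ _) => //=.
    * by rewrite szl; lia.
    * by move=> _ <-; rewrite szl.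
    * by rewrite /aget /= size_nseq.
    * by move=> i t lti _; rewrite /aget /iget /= nth_take // -szl.
  + by lia.
  apply: runs_then_eq (runs_new _ _ _) _ _ => /=; rewrite /aget /= szl.
    by lia.
  apply: (runs_then_eq (T1 := (size s - h) * 14 + 6)
    (f1 := Frame [:: n; (size s - h)%N] [::] [:: s; l; r])).
  + apply: runs_weaken (runs_fill _ (u := r) _ _ _ _) => //=.
    * by rewrite szr; lia.
    * by move=> _ <-; rewrite szr.
    * by rewrite /aget /= size_nseq.
    * by move=> i t lti _; rewrite /aget /iget /= szl nth_drop.
  + by lia.
  apply: runs_then; first by
    apply: (runs_call (Q := eq (Frame [:: n; (size s - h)%N] [::]
      [:: s; sort >=%R l; r]))); apply: runs_weaken (IH l _ _);
    [exact: leqnn|move=> g -> | rewrite szl; lia].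
  - by rewrite /aget /= szl; lia.
  move=> _ <-.
  apply: runs_then; first by
    apply: (runs_call (Q := eq (Frame [:: n; (size s - h)%N] [::]
      [:: s; sort >=%R l; sort >=%R r]))); apply: runs_weaken (IH r _ _);
    [exact: leqnn|move=> g -> | rewrite szr; lia].
  - by rewrite /aget /= szl szr; lia.
  move=> _ <-; rewrite /aget /= szl szr.
  have := @runs_merge [:: merge_sort] n (size s - h) s
    (sort >=%R l) (sort >=%R r).
  rewrite !size_sort szl szr => /(_ ltac:(lia)).
  apply: runs_weaken => [|f]; first by lia.
  (* Both sides are sorted permutations of the input. *)
  rewrite /aget => ->; apply: (sorted_eq ge_trans ge_anti).
  - by apply: (merge_sorted ge_total); apply: (sort_sorted ge_total).
  - exact: (sort_sorted ge_total).
  rewrite perm_merge perm_sym perm_sort -{1}(cat_take_drop h s).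
  by apply: perm_cat; rewrite perm_sym perm_sort.
- rewrite -leqNgt => le1; apply: runs_weaken (runs_skip _) => [|_ <-].
    by rewrite /merge_sort_time; lia.
  by case: s le1 {leN} => [|x [|y s]].
Qed.
End MergeSort.

(** * Time bounds space *)

Section Space.
Context {R : realType}.
Implicit Types (f g : frame R) (c : cmd).

(** One write into register or array number [a] may create all those of smaller
    number; [span c] bounds this by a constant of the program text. *)
Fixpoint span c : nat :=
  match c with
  | Skip => 0
  | ISet a _ | RSet a _ | New a _ | Put a _ _ | Call a _ _ _ => a.+1
  | Then c1 c2 | If _ c1 c2 => maxn (span c1) (span c2)
  | While _ c1 => span c1
  end.

Lemma isize_gt0 e : (0 < isize e)%N. Proof. by case: e. Qed.

(** An equation rather than a bound: overwriting a cell of an array must not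
    count as allocating that array again. *)
Lemma sumn_size_set_nth (ss : seq (seq R)) a s :
  (sumn (map size (set_nth [::] ss a s)) + size (nth [::] ss a)
   = sumn (map size ss) + size s)%N.
Proof.
elim: ss a => [|s0 ss IH] [|a] /=; try lia.
  by elim: a => [|a IHa] /=; lia.
by have := IH a; lia.
Qed.

Lemma cells_iset f x n : (cells (iset f x n) <= cells f + x.+1)%N.
Proof. by rewrite /cells /= size_set_nth; lia. Qed.

Lemma cells_rset f x v : (cells (rset f x v) <= cells f + x.+1)%N.
Proof. by rewrite /cells /= size_set_nth; lia. Qed.

Lemma cells_aset f a s :
  (cells (aset f a s) + size (aget f a) <= cells f + a.+1 + size s)%N.
Proof.
have := sumn_size_set_nth (arrs f) a s.
by rewrite /cells /aget /= size_set_nth; lia.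
Qed.

Lemma size_aget f a : (size (aget f a) <= cells f)%N.
Proof.
rewrite /cells /aget.
suff: (size (nth [::] (arrs f) a) <= sumn (map size (arrs f)))%N by lia.
by elim: (arrs f) a => [|s ss IH] [|a] //=; [lia | have := IH a; lia].
Qed.

Lemma exec_cells P f c t q f' : exec P f c t q f' -> (cells f' <= q)%N.
Proof.
elim=> //= *; rewrite ?leq_maxr //.
all: by apply: leq_trans (leq_maxr _ _).
Qed.

(** A step creates at most [K] registers or array descriptors, and every array
    cell that is allocated or copied is paid for by one step.  A call also opens
    an activation with one register and one descriptor, which the constant 3
    covers; the array that it returns is among the cells of the callee, already
    paid for. *)
Lemma exec_space P K f c t q f' :
  (forall p, span (nth Skip P p) <= K)%N -> (span c <= K)%N ->
  exec P f c t q f' -> (q <= cells f + K.+3 * t)%N.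
Proof.
move=> PK cK ex; elim: ex cK => {f c t q f'} /=.
- by move=> *; lia.
- move=> f x e xK; have := cells_iset f x (ieval f e).
  by rewrite mulnS; lia.
- move=> f x e xK; have := cells_rset f x (reval f e).
  by rewrite mulnS; lia.
- move=> f a e aK; have := cells_aset f a (nseq (ieval f e) 0).
  rewrite size_nseq mulnS mulnDr.
  have := leq_pmull (ieval f e) (ltn0Sn K.+2).
  by move: (cells (aset _ _ _)) => u; lia.
- move=> f a i e ltis aK.
  have := cells_aset f a (set_nth 0 (aget f a) (ieval f i) (reval f e)).
  rewrite size_set_nth (maxn_idPr ltis) mulnS.
  by move: (cells (aset _ _ _)) => u; lia.
- move=> f a p b e t q g ex IH aK; have {}IH := IH (PK p).
  have := cells_aset f a (aget g 0).
  have := size_aget g 0; have := exec_cells ex.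
  have e2 : cells (call_frame (aget f b) (ieval f e)) = (size (aget f b)).+2.
    by rewrite /cells /=; lia.
  rewrite e2 in IH; have := isize_gt0 e.
  have := leq_pmull (isize e) (ltn0Sn K.+2).
  have := leq_pmull (size (aget f b)) (ltn0Sn K.+2).
  by rewrite mulnS !mulnDr; move: (cells (aset _ _ _)) => u; lia.
- move=> f1 f2 f3 c1 c2 t1 t2 q1 q2 ex1 IH1 ex2 IH2.
  rewrite geq_max => /andP[/IH1 {}IH1 /IH2 {}IH2].
  by have := exec_cells ex1; lia.
- move=> f f' b c1 c2 t q ex IH; rewrite geq_max => /andP[K1 K2].
  suff: (q <= cells f + K.+3 * t)%N by nia.
  by apply: IH; case: ifP.
- by move=> *; lia.
- move=> f1 f2 f3 b c t1 t2 q1 q2 _ ex1 IH1 ex2 IH2 cK.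
  by have := IH1 cK; have := IH2 cK; have := exec_cells ex1; nia.
Qed.

Lemma program_span P c : exists K,
  (forall p, span (nth Skip P p) <= K)%N /\ (span c <= K)%N.
Proof.
exists (maxn (span c) (\max_(i < size P) span (nth Skip P i))); split=> [p|]; last exact: leq_maxl.
case: (ltnP p (size P)) => [ltp|/(nth_default Skip) -> //].
by apply: leq_trans (leq_maxr _ _); exact: (leq_bigmax (Ordinal ltp)).
Qed.

End Space.

(** * Orders of growth *)

Section Growth.
Context {R : realType}.
Local Open Scope classical_set_scope.
Local Open Scope ring_scope.

(** The constant [b] is absorbed by [b * m] as soon as [m] is positive, so it is
    enough that [g] dominates the identity. *)
Lemma affine_growth (g : nat -> R) (T : nat -> nat) (a b : nat) :
  (fun m => m%:R : R) =O_\oo g -> (fun m => (T m)%:R : R) =O_\oo g ->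
  (fun m => (a * T m + b * m + b)%N%:R : R) =O_\oo g.
Proof.
move=> /eqO_exP[k1 k1_gt0 H1] /eqO_exP[k2 k2_gt0 H2]; apply/eqO_exP.
exists (a%:R * k2 + (b + b)%:R * k1 + 1).
  by rewrite ltr_wpDl // addr_ge0 // mulr_ge0 // ltW.
near=> m; have m_gt0 : (1 <= m)%N by near: m; exact: nbhs_infty_ge.
have h1 : `|m%:R : R| <= k1 * `|g m| by near: m.
have h2 : `|(T m)%:R : R| <= k2 * `|g m| by near: m.
rewrite !normr_nat in h1 h2 *.
have {}h1 : (b + b)%:R * m%:R <= (b + b)%:R * (k1 * `|g m|) by rewrite ler_wpM2l.
have {}h2 : a%:R * (T m)%:R <= a%:R * (k2 * `|g m|) by rewrite ler_wpM2l.
apply: (@le_trans _ _ (a%:R * (T m)%:R + (b + b)%:R * m%:R)).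
  by rewrite -!natrM -natrD ler_nat; nia.
rewrite !mulrDl -!mulrA mul1r; apply: (le_trans (lerD h2 h1)).
by rewrite lerDl.
Unshelve. all: by end_near. Qed.

Lemma identity_growth : linear_growth R (fun m => m).
Proof. by apply/eqO_exP; exists 1 => //; near=> m; rewrite mul1r.
Unshelve. all: by end_near. Qed.

(** For [m >= 2], [ln m >= ln 2 > 0]. *)
Lemma linear_linearithmic :
  (fun m => m%:R : R) =O_\oo (fun m => m%:R * ln m%:R : R).
Proof.
have l2 : 0 < ln (2 : R) by rewrite ln_gt0 // ltr1n.
apply/eqO_exP; exists (ln 2)^-1; first by rewrite invr_gt0.
near=> m; have m_ge2 : (2 <= m)%N by near: m; exact: nbhs_infty_ge.
rewrite normrM [`|m%:R|]ger0_norm // mulrCA ler_peMr // mulrC.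
rewrite ler_pdivlMr // mul1r; apply: le_trans (ler_norm _).
by rewrite ler_ln ?posrE ?ltr0n ?ler_nat //; lia.
Unshelve. all: by end_near. Qed.

Lemma trunc_log_ln m : (0 < m)%N ->
  (trunc_log 2 m)%:R * ln 2 <= ln m%:R :> R.
Proof.
move=> m0; rewrite mulr_natl -lnXn ?ltr0n // -natrX.
rewrite ler_ln ?posrE ?ltr0n ?ler_nat ?expn_gt0 //.
exact: trunc_logP.
Qed.

(** [up_log 2 m <= trunc_log 2 m + 1], and [trunc_log 2 m * ln 2 <= ln m]. *)
Lemma merge_sort_time_growth : linearithmic_growth R merge_sort_time.
Proof.
pose T m := (m * trunc_log 2 m)%N.
have TO : (fun m => (T m)%:R : R) =O_\oo (fun m => m%:R * ln m%:R : R).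
  have l2 : 0 < ln (2 : R) by rewrite ln_gt0 // ltr1n.
  apply/eqO_exP; exists (ln 2)^-1; first by rewrite invr_gt0.
  near=> m; have m_gt0 : (0 < m)%N by near: m; exact: nbhs_infty_ge.
  rewrite normrM !ger0_norm ?ln_ge0 ?ler1n // natrM mulrCA ler_wpM2l //.
  by rewrite mulrC ler_pdivlMr // trunc_log_ln.
rewrite /linearithmic_growth.
have /eqO_exP[k k0 H] := affine_growth 100 200 linear_linearithmic TO.
apply/eqO_exP; exists k => //; near=> m.
have h : `|(100 * T m + 200 * m + 200)%N%:R : R| <= k * `|m%:R * ln m%:R|.
  by near: m.
apply: le_trans h; rewrite !normr_nat ler_nat /merge_sort_time /T.
have ul : (up_log 2 m <= (trunc_log 2 m).+1)%N.
  by apply: up_log_min => //; exact/ltnW/trunc_log_ltn.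
have := leq_mul (leqnn m) ul; rewrite !mulnS; lia.
Unshelve. all: by end_near. Qed.

End Growth.

(** * The classifier around its selection step *)

Section Classifier.
Context {R : realType}.
Implicit Types (s : seq R) (f : frame R).

Lemma runs_sum P f x n y a N : (y < size (rregs f))%N ->
  (forall i v, ieval (iset (rset f y v) x i) n = N) ->
  runs P f (for_ x n (RSet y (RAdd (RVar y) (RGet a (IVar x)))))
    (N * (isize n + 12) + isize n + 5)
    (eq (iset (rset f y (rget f y + \sum_(j < N) (aget f a)`_j)) x N)).
Proof.
move=> lty evn; set s := aget f a.
pose F i := iset (rset f y (rget f y + \sum_(j < i) s`_j)) x i.
have H : runs P f (for_ x n (RSet y (RAdd (RVar y) (RGet a (IVar x)))))
    (N * (isize n + 5 + 7) + isize n + 5) (fun f' => f' = F N).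
  apply: (runs_for (Inv := fun i f' => f' = F i)) => [i _ ->|i _ ltiN ->|].
  - by rewrite iget_iset evn.
  - apply: runs_weaken (runs_rset _ _ _) => // _ <- /=.
    have -> : iget (rset (F i) y (rget (F i) y + (aget (F i) a)`_(iget (F i) x))) x = i.
      exact: iget_iset.
    rewrite iget_iset.
    have -> : rget (F i) y = rget f y + \sum_(j < i) s`_j.
      by rewrite /rget /= nth_set_nth /= eqxx.
    rewrite /F big_ord_recr /= addrA.
    have -> g i' w : rset (iset g x i') y w = iset (rset g y w) x i' by [].
    by rewrite iset_iset rset_rset.
  - rewrite /F big_ord0 addr0 /rset /rget.
    case: f lty {evn s F} => ir rr ar /= lty; congr (iset (Frame _ _ _) _ _).
    apply: (@eq_from_nth _ 0); first by rewrite size_set_nth (maxn_idPr lty).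
    by move=> j _; rewrite nth_set_nth /=; case: eqP => [->|].
by apply: runs_weaken H => [|_ ->] //; lia.
Qed.

Lemma sum_take s k : (k <= size s)%N ->
  \sum_(j < k) s`_j = \sum_(x <- take k s) x.
Proof.
move=> leks; rewrite [RHS](big_nth 0) big_mkord size_takel //.
by apply: eq_bigr => j _; rewrite nth_take.
Qed.

Lemma sort_rcons s x :
  sort >=%R (rcons s x) = merge >=%R [:: x] (sort >=%R s).
Proof.
apply: (sorted_eq ge_trans ge_anti); first exact: (sort_sorted ge_total).
  by apply: (merge_sorted ge_total) => //; exact: (sort_sorted ge_total).
rewrite perm_sort perm_rcons perm_sym perm_merge /= perm_cons.
by rewrite perm_sort.
Qed.

(** One step of the scan for the two largest entries.  Nonnegativity makes the
    default value 0 of the missing order statistics of a short sequence behave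
    as an entry. *)
Lemma order_stat_rcons s x : 0 <= x -> all (>= 0) s ->
  (order_stat (rcons s x) 0, order_stat (rcons s x) 1) =
  if order_stat s 0 < x then (x, order_stat s 0)
  else (order_stat s 0, if order_stat s 1 < x then x else order_stat s 1).
Proof.
move=> x0 s0; rewrite /order_stat sort_rcons.
have t0 : all (>= 0) (sort >=%R s) by rewrite all_sort.
have: sorted >=%R (sort >=%R s) by exact: (sort_sorted ge_total).
case: (sort >=%R s) t0 => [|a [|b t]] /=.
- by case: ltgtP x0 => // <-.
- move=> _ _; case: (ltgtP a x) => [ax|xa|->] //=.
    by case: ltgtP x0 => // <-.
  by case: ltgtP x0 => // <-.
- move=> _ /andP[ba _]; case: (ltgtP a x) => [ax|xa|<-] //=.
    by case: (ltgtP b x) => [||->].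
  by case: ltgtP ba => // ->.
Qed.

Definition count_loop : cmd :=
  for_ xi (ILen abar)
     (If (BRlt (RVar ydelta) (RGet abar (IVar xi)))
       (ISet xcount (IAdd (IVar xcount) (ILit 1))) Skip).

Lemma runs_count P k i0 d rr s s1 s2 :
  runs P (Frame [:: k; i0; 0%N] (d :: rr) [:: s; s1; s2]) count_loop
   (size s1 * 17 + 6)
   (eq (Frame [:: k; size s1; count (> d) s1] (d :: rr) [:: s; s1; s2])).
Proof.
pose F i := Frame [:: k; i; count (> d) (take i s1)] (d :: rr) [:: s; s1; s2].
apply: runs_weaken (runs_for (Inv := fun i f => f = F i) (N := size s1) (B := 9) _ _ _) => //.
- by rewrite /=; lia.
- by move=> f ->; rewrite /F take_size.
- by move=> i f ->.
- move=> i f lti ->; have takeS : count (> d) (take i.+1 s1) =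
      (count (> d) (take i s1) + (d < s1`_i)%R)%N.
    by rewrite (take_nth 0 lti) -cats1 count_cat /= addn0.
  apply: runs_if => //= [lt|/negPf lt]; rewrite /F takeS lt.
  + by apply: runs_weaken (runs_iset _ _ _) => // _ <-.
  + by apply: runs_weaken (runs_skip _) => // _ <-; rewrite addn0.
- by rewrite /F take0.
Qed.

Definition top_two_loop : cmd :=
  for_ xi (ILen abar)
     (If (BRlt (RVar ymax) (RGet abar (IVar xi)))
       (RSet ytau (RVar ymax) ;; RSet ymax (RGet abar (IVar xi)))
       (If (BRlt (RVar ytau) (RGet abar (IVar xi)))
         (RSet ytau (RGet abar (IVar xi))) Skip))%prog.

Lemma runs_top_two P k i0 c r0 r1 r2 r3 r4 r5 r6 s s1 s2 :
  all (>= 0) s1 ->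
  runs P (Frame [:: k; i0; c] [:: r0; r1; r2; r3; r4; r5; r6; 0; 0] [:: s; s1; s2])
   top_two_loop (size s1 * 30 + 6)
   (eq (Frame [:: k; size s1; c] [:: r0; r1; r2; r3; r4; r5; r6;
      order_stat s1 0; order_stat s1 1] [:: s; s1; s2])).
Proof.
move=> s1_ge0.
pose F i := Frame [:: k; i; c] [:: r0; r1; r2; r3; r4; r5; r6;
      order_stat (take i s1) 0; order_stat (take i s1) 1] [:: s; s1; s2].
apply: runs_weaken (runs_for (Inv := fun i f => f = F i) (N := size s1) (B := 22) _ _ _) => //.
- by rewrite /=; lia.
- by move=> f ->; rewrite /F take_size.
- by move=> i f ->.
- move=> i f lti ->.
  have x_ge0 : 0 <= s1`_i by apply: (allP s1_ge0); exact: mem_nth.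
  have t_ge0 : all (>= 0) (take i s1).
    by apply/allP => y /mem_take; exact: (allP s1_ge0).
  have := order_stat_rcons x_ge0 t_ge0; rewrite -(take_nth 0 lti) => stats.
  rewrite /F; apply: runs_if => //= [lt|/negPf lt].
    rewrite lt in stats; case: stats => -> ->.
    apply: runs_then_eq (runs_rset _ _ _) _ _ => //=.
    by apply: runs_weaken (runs_rset _ _ _) => // _ <-.
  rewrite lt in stats; case: stats => -> stats.
  apply: runs_if => //= [lt2|/negPf lt2]; rewrite lt2 in stats; rewrite stats.
    by apply: runs_weaken (runs_rset _ _ _) => // _ <-.
  by apply: runs_weaken (runs_skip _) => // _ <-.
- by rewrite /F take0.
Qed.

Lemma card_tnth m (t : m.-tuple R) (d : R) :
  #|[set i : 'I_m | d < tnth t i]%classic| = count (> d) t.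
Proof.
rewrite -sum1_count big_tuple -sum1_card; apply: eq_bigl => i.
exact: asboolb.
Qed.

(** The early exits of the program and the conditionals of the function that it
    computes match one to one; this rule peels one of each. *)
Lemma runs_return_if P f b r c2 T v : (bsize b + 3 <= T)%N ->
  runs P f c2 (T - (bsize b).+1) (fun g => iget g xout = regime_code v) ->
  runs P f (If b (return_ r) c2) T
    (fun g => iget g xout = regime_code (if beval f b then r else v)).
Proof.
move=> leT run2; apply: runs_if; first by lia.
  move=> ->; apply: runs_weaken (runs_iset _ _ _) => [|_ <-] /=; first by lia.
  by rewrite iget_iset.
by move=> /negPf ->.
Qed.

(** The remaining budget is a long iterated truncated subtraction; regrouping it
    into a single one spares [lia] a case distinction per operation. *)
Ltac within_budget := rewrite -?subnDA; lia.

(** Up to the call, all frames are explicit.  The order in which the selection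
    routine leaves the top [k] values is unknown, but their sum does not depend
    on it. *)
Lemma runs_classifier P p T m (I : instance R m) :
  partial_selection_routine R P p T ->
  runs P (input_frame I) (classifier p) (T m + (100 * m + 100))
    (fun f => iget f xout = regime_code (regime_classifier I)).
Proof.
move=> selP; rewrite /regime_classifier /classifier /input_frame.
set L := \sum_(i < m) tnth (lam I) i.
have [k1 km] : (1 <= topk I)%N /\ (topk I <= m)%N by have := topk_bounds I; lia.
pose u := [seq x / L | x <- lam I].
have szu : size u = m by rewrite size_map size_tuple.
have barE : tval [tuple tnth (lam I) i / L | i < m] = u.
  apply: (@eq_from_nth _ 0); first by rewrite size_tuple szu.
  move=> i; rewrite size_tuple => lti.
  rewrite -(tnth_nth 0 _ (Ordinal lti)) tnth_mktuple (nth_map 0) ?size_tuple //.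
  by rewrite (tnth_nth 0).
(* The leading 0 is the initial value of the accumulator. *)
have LE : L = 0 + \sum_(j < m) (tval (lam I))`_j.
  by rewrite add0r; apply: eq_bigr => j _; rewrite (tnth_nth 0).
have L_ge0 : 0 <= L by apply: sumr_ge0 => i _; exact: lam_ge0.
have u_ge0 : all (>= 0) u.
  apply/allP => _ /mapP[y /(nthP 0)[i lti <-] ->]; apply: divr_ge0 => //.
  rewrite size_tuple in lti.
  by rewrite -(tnth_nth 0 _ (Ordinal lti)) lam_ge0.
cbv zeta; rewrite card_tnth barE.
apply: runs_then_eq (runs_rset _ _ _) _ _ => /=; first by within_budget.
apply: runs_then_eq (runs_sum (N := m) _ _ _ _) _ _ => //=.
  by move=> i v; rewrite /aget /= size_tuple.
  by within_budget.
rewrite /rset /iset /rget /aget /= -LE.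
apply: runs_return_if => /=; first by within_budget.
apply: runs_return_if => /=; first by within_budget.
apply: runs_then_eq (runs_new _ _ _) _ _ => /=; rewrite /aget /= size_tuple.
  by within_budget.
apply: (runs_then_eq (T1 := m * 14 + 6)
  (f1 := Frame [:: topk I; m] [:: delta I; theta I; gamma I; eps I; L]
           [:: tval (lam I); u])).
- apply: runs_weaken (runs_fill _ (u := u) _ _ _ _) => //=.
  + by rewrite szu; within_budget.
  + by move=> _ <-; rewrite szu.
  + by rewrite /aget /= size_nseq szu.
  + by move=> i t _; rewrite /aget /= size_tuple szu.
  + move=> i t lti _; rewrite /aget /iget /rget /= (nth_map 0) //.
    by rewrite size_tuple -szu.
- by within_budget.
apply: (runs_then (T1 := (m + T m).+2) (Q1 := fun f => exists2 top,
  perm_eq (take (topk I) top) (take (topk I) (sort >=%R u)) &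
  f = Frame [:: topk I; m] [:: delta I; theta I; gamma I; eps I; L]
           [:: tval (lam I); u; top])).
- have [t [q [g [ex perm_g let1]]]] := selP u (topk I) ltac:(by rewrite szu k1).
  apply: (@runs_weaken _ _ _ _ (isize (IVar xk) + size u + T m).+1%N).
  + by rewrite szu /=; lia.
  + by move=> f; exact.
  apply: runs_call; exists t, q, g; split; [exact: ex|by rewrite -szu|].
  by exists (aget g 0).
- by within_budget.
move=> _ [top perm_top ->].
have ktop : (topk I <= size top)%N.
  have := perm_size perm_top.
  by rewrite !size_take_min size_sort szu; lia.
have SigmaE : \sum_(j < topk I) order_stat u j = 0 + \sum_(j < topk I) top`_j.
  rewrite add0r !sum_take ?size_sort ?szu //.
  by apply: perm_big; rewrite perm_sym.
apply: runs_then_eq (runs_rset _ _ _) _ _ => /=; first by within_budget.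
apply: runs_then_eq (runs_sum (N := topk I) _ _ _ _) _ _ => //=.
  by within_budget.
rewrite /rset /iset /rget /aget /= -SigmaE.
apply: runs_return_if => /=; first by within_budget.
apply: runs_return_if => /=; first by within_budget.
apply: runs_then_eq (runs_iset _ _ _) _ _ => /=; first by within_budget.
rewrite /iset /=.
apply: runs_then_eq (runs_count _ _ _ _ _ _ _ _) _ _ => /=.
  by rewrite szu; within_budget.
apply: runs_then_eq (runs_rset _ _ _) _ _ => /=; first by rewrite szu; within_budget.
rewrite /rset /aget /iget /= size_tuple szu.
apply: runs_return_if => /=; first by within_budget.
apply: runs_then_eq (runs_rset _ _ _) _ _ => /=; first by within_budget.
apply: runs_then_eq (runs_rset _ _ _) _ _ => /=; first by within_budget.
apply: runs_then_eq (runs_top_two _ _ _ _ _ _ _ _ _ _ _ _ _ u_ge0) _ _ => /=.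
  by rewrite szu; within_budget.
rewrite szu.
apply: runs_return_if => /=; first by within_budget.
apply: runs_return_if => /=; first by within_budget.
apply: runs_weaken (runs_iset _ _ _) => [|_ <-] //=; within_budget.
Qed.
End Classifier.

Unset Implicit Arguments.

Theorem proposition10 (R : realType) :
  (forall (P : seq cmd) (p : nat),
     (exists T, linear_growth R T /\ partial_selection_routine R P p T) ->
     exists T S : nat -> nat,
       [/\ linear_growth R T, linear_growth R S
         & forall (m : nat) (I : instance R m),
           exists (t q : nat) (f : frame R),
             [/\ exec P (input_frame I) (classifier p) t q f,
                 iget f xout = regime_code (regime_classifier I),
                 (t <= T m)%N & (q <= S m)%N]])
  /\
  (forall (P : seq cmd) (p : nat),
     (exists T, linearithmic_growth R T /\ sorting_routine R P p T) ->
     exists T : nat -> nat,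
       linearithmic_growth R T /\
       forall (m : nat) (I : instance R m),
         exists (t q : nat) (f : frame R),
           [/\ exec P (input_frame I) (classifier p) t q f,
               iget f xout = regime_code (regime_classifier I)
             & (t <= T m)%N])
  /\
  (exists (P : seq cmd) (p : nat),
     exists T, linearithmic_growth R T /\ sorting_routine R P p T).
Proof.
split; [|split] => [P p [T [linT selP]]|P p [T [nlogT sortP]]|].
- have [K [PK cK]] := program_span P (classifier p).
  pose time m := (1 * T m + 100 * m + 100)%N.
  have time_lin : linear_growth R time.
    exact: affine_growth identity_growth linT.
  exists time, (fun m => (K.+3 * time m + 6 * m + 6)%N).
  split=> [||m I]; first exact: time_lin.
    exact: affine_growth identity_growth time_lin.
  have [t [q [f [ex let1 out]]]] := runs_classifier I selP.
  have le_time : (t <= time m)%N by rewrite /time; lia.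
  exists t, q, f; split; [exact: ex|exact: out|exact: le_time|].
  apply: leq_trans (exec_space PK cK ex) _.
  (* One integer register, four reals, the descriptor and cells of [lam I]. *)
  have -> : cells (input_frame I) = (m + 6)%N.
    by rewrite /cells /= size_tuple; lia.
  by have := leq_mul (leqnn K.+3) le_time; lia.
- exists (fun m => (1 * T m + 100 * m + 100)%N); split=> [|m I].
    exact: affine_growth linear_linearithmic nlogT.
  have selP : partial_selection_routine R P p T.
    move=> s k _; have [t [q [g [ex eg let1]]]] := sortP s k.
    by exists t, q, g; split; [exact: ex|rewrite eg|exact: let1].
  have [t [q [f [ex let1 out]]]] := runs_classifier I selP.
  by exists t, q, f; split; [exact: ex|exact: out|lia].
- exists [:: merge_sort], 0%N, merge_sort_time.
  split=> [|s n]; first exact: merge_sort_time_growth.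
  have [t [q [g [ex let1 out]]]] := runs_merge_sort s n.
  by exists t, q, g; split; [exact: ex|exact: out|exact: let1].
Qed.
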